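(* Let $p,q$ be integers with $0<p\le q/2$ and $\gcd(p,q)=1$, and let $\mathbb P$ be the projective toric surface whose fan in $\mathbb Q^2$ has one-dimensional cones generated by $(1,0),(p,q),(-1,0),(-p,-q)$. Let $\mathrm{Bl}_e\mathbb P$ be the blowing-up of $\mathbb P$ at a point $e$ of the big torus, with exceptional divisor $E$. With the integers $n,b_i,\beta_i$ and the classes $C_i$ ($0\le i\le n$) defined in the context, $$\mathrm{Eff}(\mathrm{Bl}_e\mathbb P)=\mathrm{Cone}\bigl(\{E\}\cup\{C_i \;:\; 0\le i\le n\ \text{and}\ 2\beta_ib_i<q\}\bigr).$$ In particular the effective cone is generated in multiplicity $1$.
   Context: The ground field is algebraically closed of characteristic $0$. Let $p/q=[c_1,c_2,\dots,c_n]$ be the Euclidean continued fraction $c_1+\cfrac1{c_2+\cfrac1{\ddots+\cfrac{1}{c_n}}}$ produced by the Euclidean algorithm (so $c_1=0$ and $c_n\ge2$). Define $a_{-1}=0,\ a_0=1,\ a_i=c_ia_{i-1}+a_{i-2}$ and $b_{-1}=1,\ b_0=0,\ b_i=c_ib_{i-1}+b_{i-2}$ for $1\le i\le n$, and $\beta_i=(-1)^i(a_iq-b_ip)$ for $0\le i\le n$. Let $H_1,H_2$ be the pullbacks to $\mathrm{Bl}_e\mathbb P$ of the classes of the torus-invariant divisors corresponding to the rays through $(1,0)$ and $(p,q)$ respectively. Then $(H_1,H_2,E)$ is a basis of $\mathrm{Cl}_{\mathbb R}(\mathrm{Bl}_e\mathbb P)=\mathrm{Cl}(\mathrm{Bl}_e\mathbb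 P)\otimes\mathbb R$, with $H_1^2=H_2^2=0$, $H_1\cdot H_2=1/q$, $H_i\cdot E=0$, $E^2=-1$. Set $C_i=b_iH_1+\beta_iH_2-E$; this is the class of the strict transform of the closure of the one-parameter subgroup $t\mapsto t^{v_i}\cdot e$ with $v_i=(a_i,b_i)$. $\mathrm{Eff}(X)\subseteq\mathrm{Cl}_{\mathbb R}(X)$ is the cone generated by classes of effective divisors. ''Generated in multiplicity $1$'' means generated by $E$ together with classes of effective divisors of the form $\pi^*A-mE$ with $0\le m\le1$, where $\pi\colon\mathrm{Bl}_e\mathbb P\to\mathbb P$ is the blowing-up morphism and $A$ is a divisor class on $\mathbb P$. *)

(* Defs.v *)
From HB Require Import structures.
From mathcomp Require Import all_boot all_order all_algebra.
From mathcomp Require Import freeg.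
From mathcomp Require Import boolp classical_sets reals.
Set Implicit Arguments.
Unset Strict Implicit.
Unset Printing Implicit Defensive.
Import Order.TTheory GRing.Theory Num.Theory.
Local Open Scope quotient_scope.
Local Open Scope classical_set_scope.
Local Open Scope ring_scope.

Section LinearAlgebra.
Variables (F : realFieldType) (V : lmodType F).

Definition spanned (S : set V) (v : V) : Prop :=
  exists (n : nat) (l : 'I_n -> F) (s : 'I_n -> V),
    (forall i, S (s i)) /\ v = \sum_(i < n) l i *: s i.

Definition cone (S : set V) : set V := [set v |
  exists (n : nat) (l : 'I_n -> F) (s : 'I_n -> V),
    [/\ forall i, 0 <= l i, forall i, S (s i) & v = \sum_(i < n) l i *: s i]].

Definition span_pred (S : set V) : {pred V} := fun v => `[< spanned S v >].

Lemma span_submod_closed S : submod_closed (span_pred S).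
Proof.
split.
  apply/asboolP; exists 0%N, (fun=> 0), (fun=> 0).
  by split; [case|rewrite big_ord0].
move=> a u v /asboolP[m [l [s [Ss ->]]]] /asboolP[k [l' [s' [Ss' ->]]]].
apply/asboolP; exists (m + k)%N.
exists (fun i => match fintype.split i with inl j => a * l j | inr j => l' j end).
exists (fun i => match fintype.split i with inl j => s j | inr j => s' j end).
split; first by move=> i; case: (fintype.split i).
rewrite big_split_ord /= scaler_sumr; congr (_ + _); apply: eq_bigr => i _.
  by rewrite (unsplitK (inl i)) scalerA.
by rewrite (unsplitK (inr i)).
Qed.

HB.instance Definition _ (S : set V) :=
  GRing.isSubmodClosed.Build F V (span_pred S) (span_submod_closed S).

Definition lquot (S : set V) := @Quotient.quot V (span_pred S).
HB.instance Definition _ S := GRing.Zmodule.on (lquot S).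
HB.instance Definition _ S := EqQuotient.on (lquot S).

Variable S : set V.

Lemma lquot_eqP (u v : V) :
  reflect (\pi_(lquot S) u = \pi_(lquot S) v) (u - v \in span_pred S).
Proof.
rewrite Quotient.idealrBE; exact: eqP.
Qed.

Lemma lquot_piD (u v : V) :
  \pi_(lquot S) (u + v) = \pi_(lquot S) u + \pi_(lquot S) v.
Proof. exact: (raddfD (\pi_(@Quotient.quot V (span_pred S)))). Qed.

Definition lquot_scale (a : F) (x : lquot S) : lquot S :=
  \pi_(lquot S) (a *: repr x).

Lemma lquot_piZ a (v : V) :
  \pi_(lquot S) (a *: v) = lquot_scale a (\pi_(lquot S) v).
Proof.
apply/lquot_eqP; rewrite -scalerBr rpredZ //.
by apply/lquot_eqP; rewrite reprK.
Qed.

Lemma lquot_scaleA a b x : lquot_scale a (lquot_scale b x) = lquot_scale (a * b) x.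
Proof.
elim/quotW: x => x.
by rewrite -(lquot_piZ b x) -(lquot_piZ a (b *: x)) -(lquot_piZ _ x) scalerA.
Qed.

Lemma lquot_scale1 : left_id 1 lquot_scale.
Proof. by elim/quotW=> x; rewrite -(lquot_piZ _ x) scale1r. Qed.

Lemma lquot_scaleDr : right_distributive lquot_scale +%R.
Proof.
move=> a; elim/quotW=> x; elim/quotW=> y.
rewrite -(lquot_piD x y) -(lquot_piZ a (x + y)) -(lquot_piZ a x) -(lquot_piZ a y).
by rewrite scalerDr lquot_piD.
Qed.

Lemma lquot_scaleDl x : {morph lquot_scale^~ x : a b / a + b}.
Proof.
elim/quotW: x => x a b /=.
by rewrite -(lquot_piZ _ x) -(lquot_piZ a x) -(lquot_piZ b x) scalerDl lquot_piD.
Qed.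

HB.instance Definition _ := GRing.Zmodule_isLmodule.Build F (lquot S)
  lquot_scaleA lquot_scale1 lquot_scaleDr lquot_scaleDl.
End LinearAlgebra.

Section FunctionField.
Variable K : fieldType.

(* f : {poly {poly K}} is read as f(x, y) with y the outer variable: the
   coefficient of x^i y^j is f`_j`_i. *)
Notation Kxy := {poly {poly K}}.

Definition var_x : Kxy := ('X : {poly K})%:P.
Definition var_y : Kxy := 'X.

Definition exponents (f : Kxy) : seq (nat * nat) :=
  [seq ij <- [seq (i, j) | j <- iota 0 (size f), i <- iota 0 (size f`_j)]
    | f`_(ij.2)`_(ij.1) != 0].

Definition min_seq (s : seq int) : int := \big[Num.min/head 0 s]_(z <- s) z.

(* The order of f along the torus-invariant curve of the ray through the
   primitive vector v is the minimum of <u, v> over the exponents u of f.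
   This and all the orders below are meaningful for f != 0 only. *)
Definition monomial_ord (v : int * int) (f : Kxy) : int :=
  min_seq [seq ij.1%:Z * v.1 + ij.2%:Z * v.2 | ij <- exponents f].

(* f(x + e.1, y + e.2) *)
Definition translate (e : K * K) (f : Kxy) : Kxy :=
  map_poly (comp_poly ('X + e.1%:P)) f \Po ('X + (e.2%:P)%:P).

(* The multiplicity at e, which is also the order along the exceptional
   divisor over e: the least total degree of a monomial in the Taylor expansion
   at e. *)
Definition mult_at (e : K * K) (f : Kxy) : int :=
  monomial_ord (1, 1) (translate e f).

Definition curve_ord (g f : Kxy) : int :=
  (xget 0%N [set m | (exists h, f = h * g ^+ m) /\
                     ~ (exists h, f = h * g ^+ m.+1)])%:Z.

Definition irreducible_elt (D : idomainType) (f : D) : Prop :=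
  [/\ f != 0, f \isn't a GRing.unit &
    forall g h, f = g * h -> g \is a GRing.unit \/ h \is a GRing.unit].

(* An irreducible curve of the torus has, up to a unit of K[x^+-1, y^+-1], a
   unique equation; it is an irreducible polynomial other than x and y, and
   becomes unique once its leading coefficient is 1. *)
Definition is_torus_curve (f : Kxy) : bool :=
  [&& `[< irreducible_elt f >], f != var_x, f != var_y
    & lead_coef (lead_coef f) == 1].

Definition torus_curve := {f : Kxy | is_torus_curve f}.
HB.instance Definition _ := Choice.on torus_curve.

End FunctionField.

(* The complete toric surface P whose rays are spanned by the primitive vectors
   vs is encoded by its prime divisors and the order of the functions of
   K(P) = K(x, y) along them. The prime divisors are the invariant curves,
   indexed by the rays, and the closures of the irreducible curves of the
   torus. The blowing-up X of P at e has as prime divisors the strict transforms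
   of those of P (Some) and the exceptional divisor E (None). *)
Section BlowupOfToricSurface.
Variables (R : realType) (K : fieldType) (e : K * K).
Variables (r : nat) (vs : r.-tuple (int * int)).

Definition primeP : Type := ('I_r + torus_curve K)%type.
HB.instance Definition _ := Choice.on primeP.
Definition primeX : Type := option primeP.
HB.instance Definition _ := Choice.on primeX.

Definition divP := {freeg primeP / int}.
Definition divX := {freeg primeX / int}.

Definition ordX (Q : primeX) (f : {poly {poly K}}) : int :=
  match Q with
  | None => mult_at e f
  | Some (inl i) => monomial_ord (tnth vs i) f
  | Some (inr g) => curve_ord (val g) f
  end.

(* D is the divisor of the rational function a / b. *)
Definition principal (D : divX) : Prop :=
  exists a b : {poly {poly K}}, [/\ a != 0, b != 0 &
    forall Q, coeff Q D = ordX Q a - ordX Q b].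

Definition linearly_equivalent (D D' : divX) : Prop := principal (D - D').

Definition effective (D : divX) : Prop := forall Q, 0 <= coeff Q D.

Definition excX : divX := << (None : primeX) >>.
Definition invariantP (i : 'I_r) : divP := << (inl i : primeP) >>.

(* e lies on no invariant curve, and the pullback of a curve is its strict
   transform plus its multiplicity at e times E. *)
Definition multP (Q : primeP) : int :=
  match Q with inl _ => 0 | inr g => mult_at e (val g) end.

Definition pullback (A : divP) : divX :=
  \sum_(Q <- dom A) coeff Q A *: (<< (Some Q : primeX) >> + multP Q *: excX).

Definition realify (D : divX) : {freeg primeX / R} :=
  \sum_(Q <- dom D) << (coeff Q D)%:~R *g Q >>.

(* Cl(X) tensored with R is the space of R-divisors modulo the real span of the
   principal divisors. *)
Definition ClR : lmodType R := lquot [set realify D | D in principal].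

Definition class (D : divX) : ClR := \pi_(lquot _) (realify D).

Definition Eff : set ClR := cone [set class D | D in effective].

Definition classE : ClR := class excX.

Definition classes_mult1 : set ClR := [set c |
  exists (D : divX) (A : divP) (m : int),
    [/\ effective D, 0 <= m <= 1,
        linearly_equivalent D (pullback A - m *: excX) & c = class D]].

Definition generated_in_multiplicity_1 : Prop :=
  Eff = cone ([set classE] `|` classes_mult1).

End BlowupOfToricSurface.

Fixpoint euclid_rec (k p q : nat) : seq nat :=
  if k is k'.+1 then
    if q == 0%N then [::] else (p %/ q)%N :: euclid_rec k' q (p %% q)%N
  else [::].

(* The partial quotients [:: c_1; ...; c_n] of the Euclidean algorithm on p, q;
   the second argument decreases strictly, so that q steps are enough. *)
Definition euclid_cf (p q : nat) : seq nat := euclid_rec q p q.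

(* (z_(i-1), z_i) for z_i = c_i z_(i-1) + z_(i-2), started at (z_(-1), z_0) = z *)
Fixpoint continuant (c : seq nat) (z : nat * nat) (i : nat) : nat * nat :=
  if i is i'.+1 then
    let: (z2, z1) := continuant c z i' in (z1, nth 0%N c i' * z1 + z2)%N
  else z.

Section TheSurface.
Variables (p q : nat).

Definition cf_length : nat := size (euclid_cf p q).
Definition cf_a (i : nat) : nat := (continuant (euclid_cf p q) (0, 1)%N i).2.
Definition cf_b (i : nat) : nat := (continuant (euclid_cf p q) (1, 0)%N i).2.
Definition cf_beta (i : nat) : int :=
  (-1) ^+ i * ((cf_a i)%:Z * q%:Z - (cf_b i)%:Z * p%:Z).

Definition rays : 4.-tuple (int * int) :=
  [tuple (1, 0); (p%:Z, q%:Z); (-1, 0); (- p%:Z, - q%:Z)].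

Variables (R : realType) (K : fieldType) (e : K * K).

Definition classH1 : ClR R e rays := class R e rays (pullback e (invariantP K (0 : 'I_4))).
Definition classH2 : ClR R e rays := class R e rays (pullback e (invariantP K (1 : 'I_4))).
Definition classC (i : nat) : ClR R e rays :=
  (cf_b i)%:R *: classH1 + (cf_beta i)%:~R *: classH2 - classE R e rays.

End TheSurface.

Arguments ClR R {K} e {r} vs.
Arguments class R {K} e {r} vs D.
Arguments Eff R {K} e {r} vs.
Arguments classE R {K} e {r} vs.
Arguments classes_mult1 R {K} e {r} vs.
Arguments generated_in_multiplicity_1 R {K} e {r} vs.
Arguments classH1 p q R {K} e.
Arguments classH2 p q R {K} e.
Arguments classC p q R {K} e i.

(* Main.v *)
(* A curve C of the torus other than C_i satisfies C.C_i >= 0: restricting its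
   equation to t |-> e t^(a_i, b_i) gives a nonzero Laurent polynomial that
   vanishes at t = 1 to order at least m = mult_e C, and whose support has length
   at most (b_i w2 + beta_i w1)/q, where [C] = w1 H1 + w2 H2 - m E. The identity
   b_(i+1) beta_i + b_i beta_(i+1) = q says that C_i.C_(i+1) = 0. As p <= q/2, the
   b_i increase strictly, so that two consecutive C_i cannot both have
   nonnegative square. Write (w1, w2) = s (b_i, beta_i) + t (b_j, beta_j), where
   C_i and C_j have negative square and either j = i + 1, or j = i + 2 and
   C_(i+1)^2 >= 0. Intersecting with C_i in the first case and with C_(i+1) in the
   second yields m <= s + t, whence [C] = s C_i + t C_j + (s + t - m) E.
   Conversely C_i is the class of an irreducible curve, since the kernel of the
   restriction is generated by a binomial, which is therefore prime. *)

From HB Require Import structures.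
Require Import Defs.
From mathcomp Require Import all_boot all_order all_algebra.
From mathcomp Require Import freeg.
From mathcomp Require Import boolp classical_sets reals.
From mathcomp Require Import zify ring.
Set Implicit Arguments.
Unset Strict Implicit.
Unset Printing Implicit Defensive.
Import Order.TTheory GRing.Theory Num.Theory.
Local Open Scope classical_set_scope.
Local Open Scope ring_scope.

(** * Cones *)

Section Cones.
Variables (F : realFieldType) (V : lmodType F).
Implicit Types (S T : set V) (u v : V).

Lemma cone0 S : cone S 0.
Proof. by exists 0%N, (fun=> 0), (fun=> 0); split=> [||]; [|case|rewrite big_ord0]. Qed.

Lemma coneD S u v : cone S u -> cone S v -> cone S (u + v).
Proof.
move=> [m [l [s [l0 Ss ->]]]] [k [l' [s' [l0' Ss' ->]]]]; exists (m + k)%N.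
exists (fun i => match fintype.split i with inl j => l j | inr j => l' j end).
exists (fun i => match fintype.split i with inl j => s j | inr j => s' j end).
split; try by move=> i; case: (fintype.split i).
rewrite big_split_ord /=; congr (_ + _); apply: eq_bigr => i _.
  by rewrite (unsplitK (inl i)).
by rewrite (unsplitK (inr i)).
Qed.

Lemma coneZ S a v : 0 <= a -> cone S v -> cone S (a *: v).
Proof.
move=> a0 [m [l [s [l0 Ss ->]]]]; exists m, (fun i => a * l i), s.
split=> // [i|]; first by rewrite mulr_ge0.
by rewrite scaler_sumr; apply: eq_bigr => i _; rewrite scalerA.
Qed.

Lemma sub_cone S v : S v -> cone S v.
Proof.
move=> Sv; exists 1%N, (fun=> 1), (fun=> v).
by rewrite big_ord1 scale1r; split.
Qed.

Lemma cone_sum S (I : eqType) (r : seq I) (G : I -> V) :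
  (forall i, i \in r -> cone S (G i)) -> cone S (\sum_(i <- r) G i).
Proof.
move=> SG; rewrite big_seq; elim/big_ind: _ => //; first exact: cone0.
exact: coneD.
Qed.

Lemma cone_min S T : S `<=` cone T -> cone S `<=` cone T.
Proof.
move=> ST v [m [l [s [l0 Ss ->]]]].
by apply: cone_sum => i _; apply: coneZ => //; apply: ST.
Qed.

End Cones.

(** * The continued fraction *)

(* The pair (beta_(i-1), beta_i), where beta_(-1) = p; see cf_remE. *)
Definition euclid_rem (p q i : nat) : nat * nat :=
  iter i (fun z => (z.2, z.1 %% z.2)%N) (p, q).

Lemma euclid_remSr p q i : euclid_rem p q i.+1 = euclid_rem q (p %% q) i.
Proof. by rewrite /euclid_rem iterSr. Qed.

Lemma euclid_rec_nth k p q i : (q <= k)%N -> (i < size (euclid_rec k p q))%N ->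
  let r := euclid_rem p q i in
  (0 < r.2)%N /\ nth 0%N (euclid_rec k p q) i = (r.1 %/ r.2)%N.
Proof.
elim: k p q i => [|k IH] p q i //= le_qk.
case: eqP => //= /eqP; rewrite -lt0n => q_gt0.
have lt_r := ltn_pmod p q_gt0.
case: i => [|i]; first by [].
by rewrite ltnS euclid_remSr => lt_i; apply: IH => //; lia.
Qed.

Lemma euclid_rem_size k p q : (q <= k)%N ->
  (euclid_rem p q (size (euclid_rec k p q))).2 = 0%N.
Proof.
elim: k p q => [|k IH] p q /=; first by rewrite leqn0 => /eqP ->.
move=> le_qk; case: eqP => //= /eqP; rewrite -lt0n => q_gt0.
have lt_r := ltn_pmod p q_gt0.
have le_k : (p %% q <= k)%N by lia.
by have := IH q _ le_k; rewrite -euclid_remSr.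
Qed.

Lemma continuantS c z i :
  continuant c z i.+1 = ((continuant c z i).2,
    nth 0 c i * (continuant c z i).2 + (continuant c z i).1)%N.
Proof. by rewrite /=; case: (continuant c z i). Qed.

Section ContinuedFraction.
Variables p q : nat.
Notation n := (cf_length p q).
Notation a := (cf_a p q).
Notation b := (cf_b p q).
Notation beta := (cf_beta p q).
Let ca i := continuant (euclid_cf p q) (0, 1)%N i.
Let cb i := continuant (euclid_cf p q) (1, 0)%N i.
Let r := euclid_rem p q.

(** Remainders and [beta] obey the same recursion up to alternating signs, so that sign, decrease
    and final vanishing of [beta] can be read off the Euclidean algorithm. The first component is
    [beta_(i-1)], written out because the index -1 occurs. *)
Lemma cf_remE i : (i <= n)%N ->
  (r i).1%:Z = - (-1) ^+ i * ((ca i).1%:Z * q%:Z - (cb i).1%:Z * p%:Z) /\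
  (r i).2%:Z = beta i.
Proof.
rewrite /cf_beta /cf_a /cf_b -/(ca i) -/(cb i).
elim: i => [|i IH] lt_in.
  by rewrite /r /ca /cb /= !expr0; split; lia.
have [IH1 IH2] := IH (ltnW lt_in).
have [r0 Ec] := euclid_rec_nth (leqnn q) lt_in.
move: IH1 IH2; rewrite /ca /cb !continuantS -/(ca i) -/(cb i) /euclid_cf Ec /=.
rewrite -/r => E1 E2; have := divn_eq (r i).1 (r i).2.
move: (_ %/ _)%N (_ %% _)%N => d m E; rewrite exprS; split; first by rewrite E2; ring.
have -> : m%:Z = (r i).1%:Z - d%:Z * (r i).2%:Z by lia.
rewrite E1 E2 !PoszD !PoszM; ring.
Qed.

(** Each step multiplies the matrix of continuants by a matrix of determinant -1. *)
Lemma cf_det i :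
  (ca i).2%:Z * (cb i).1%:Z - (ca i).1%:Z * (cb i).2%:Z = (-1) ^+ i.
Proof.
elim: i => [|i IH]; first by rewrite /ca /cb /= expr0.
rewrite exprS -IH /ca /cb !continuantS -/(ca i) -/(cb i) /= !PoszD !PoszM.
ring.
Qed.

Lemma cf_beta_ge0 i : (i <= n)%N -> 0 <= beta i.
Proof. by case/cf_remE => _ <-. Qed.

Lemma cf_beta_last : beta n = 0.
Proof. by have [_ <-] := cf_remE (leqnn n); rewrite /r euclid_rem_size. Qed.

Lemma cf_beta_decr i : (i < n)%N -> beta i.+1 < beta i.
Proof.
move=> lt_in; have [_ <-] := cf_remE lt_in; have [_ <-] := cf_remE (ltnW lt_in).
have [r0 _] := euclid_rec_nth (leqnn q) lt_in.
by rewrite ltz_nat /r /= ltn_pmod.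
Qed.

Lemma cf_ab_det i : (a i.+1)%:Z * (b i)%:Z - (a i)%:Z * (b i.+1)%:Z = - (-1) ^+ i.
Proof.
have := cf_det i.+1; rewrite /ca /cb !continuantS /cf_a /cf_b exprS !continuantS /=.
by move=> ->; rewrite mulN1r.
Qed.

(** The terms in [p] cancel, which leaves [q] times, up to sign, the determinant of [cf_ab_det]. *)
Lemma cf_b_beta i : (b i.+1)%:Z * beta i + (b i)%:Z * beta i.+1 = q%:Z.
Proof.
rewrite /cf_beta exprS.
transitivity (- ((-1) ^+ i * ((a i.+1)%:Z * (b i)%:Z - (a i)%:Z * (b i.+1)%:Z)) * q%:Z).
  by ring.
by rewrite cf_ab_det mulrN opprK -exprMn mulrNN mulr1 expr1n mul1r.
Qed.

Lemma cf_coprime i : coprime (a i) (b i).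
Proof.
have := cf_ab_det i; rewrite -signr_odd => det.
have : ((gcdn (a i) (b i))%:Z %| 1)%Z.
  have d1 : ((gcdn (a i) (b i))%:Z %| (a i)%:Z)%Z by rewrite dvdzE dvdn_gcdl.
  have d2 : ((gcdn (a i) (b i))%:Z %| (b i)%:Z)%Z by rewrite dvdzE dvdn_gcdr.
  have : ((gcdn (a i) (b i))%:Z %| - (-1) ^+ (odd i))%Z.
    by rewrite -det; apply: rpredB; [apply: dvdz_mull | apply: dvdz_mulr].
  by case: (odd i); rewrite ?expr1 ?expr0 ?opprK // dvdzN.
by rewrite dvdzE /= dvdn1.
Qed.

Hypotheses (p_gt0 : (0 < p)%N) (le_2p_q : (2 * p <= q)%N).

(** Here [b 0 = 0], [b 1 = 1] and [b 2 = c_2 = q %/ p], which is at least 2 since [2 * p <= q];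
    afterwards the recursion adds the positive [b i]. *)
Lemma cf_b_incr i : (i < n)%N -> (b i < b i.+1)%N.
Proof.
suff H : (i < n)%N -> (b i < b i.+1)%N /\ ((0 < i)%N -> (0 < b i)%N).
  by move=> /H[].
elim: i => [|i IH] lt_in.
  have := cf_det 1; rewrite /ca /cb /cf_b !continuantS /= ; lia.
have [IH1 IH2] := IH (ltnW lt_in).
have [r0 Ec] := euclid_rec_nth (leqnn q) lt_in.
split; last by lia.
have [r0' _] := euclid_rec_nth (leqnn q) (ltnW lt_in).
have lt_r : ((r i.+1).2 < (r i.+1).1)%N by rewrite /r /= ltn_pmod.
have c_gt0 : (0 < nth 0 (euclid_cf p q) i.+1)%N.
  by rewrite /euclid_cf Ec divn_gt0 // ltnW.
have EbS : b i.+2 = (nth 0 (euclid_cf p q) i.+1 * b i.+1 + b i)%N.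
  by rewrite /cf_b !continuantS.
rewrite EbS; case: i IH1 IH2 Ec lt_in c_gt0 {IH r0 r0' lt_r EbS} =>
    [|i] IH1 IH2 Ec lt_in c_gt0.
  have -> : b 0 = 0%N by [].
  have : (1 < nth 0 (euclid_cf p q) 1)%N.
    rewrite /euclid_cf Ec /= modn_small ?leq_divRL //; lia.
  nia.
have := IH2 isT; nia.
Qed.

Lemma cf_length_gt0 : (0 < n)%N.
Proof. by rewrite /cf_length /euclid_cf; case: q le_2p_q => //; lia. Qed.

(** As [C_i^2 = 2 * beta i * b i / q - 1], each inequality means a negative square. By [cf_b_beta]
    the sum of the two squares is [- 2 / q] times the product of the increase of [b] and the
    decrease of [beta]. *)
Lemma cf_negative_consecutive i : (i < n)%N ->
  2 * beta i * (b i)%:Z < q%:Z \/ 2 * beta i.+1 * (b i.+1)%:Z < q%:Z.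
Proof.
move=> lt_in; have lt_b := cf_b_incr lt_in; have lt_beta := cf_beta_decr lt_in.
have E := cf_b_beta i.
have : 0 < ((b i.+1)%:Z - (b i)%:Z) * (beta i - beta i.+1) by apply: mulr_gt0; lia.
lia.
Qed.

(** The vectors [(b i, beta i)] turn from the second axis at [i = 0] to the first at [i = n], so
    that two consecutive ones enclose [(w1, w2)]. *)
Lemma cf_crossing (w1 w2 : int) : 0 <= w1 -> 0 <= w2 ->
  exists i, [/\ (i < n)%N, (b i)%:Z * w2 <= beta i * w1 &
                beta i.+1 * w1 <= (b i.+1)%:Z * w2].
Proof.
move=> w1_ge0 w2_ge0.
(* Go down from [k = n], where the inequality holds because [beta n = 0], until the comparison
   changes sign. *)
suff H k : (k <= n)%N -> beta k * w1 <= (b k)%:Z * w2 ->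
    exists i, [/\ (i < n)%N, (b i)%:Z * w2 <= beta i * w1 &
                  beta i.+1 * w1 <= (b i.+1)%:Z * w2].
  by apply: (H n) => //; rewrite cf_beta_last mul0r mulr_ge0.
have b0w : (b 0)%:Z * w2 <= beta 0 * w1.
  by rewrite mul0r mulr_ge0 // cf_beta_ge0.
elim: k => [_ le_k|k IH lt_kn le_k].
  exists 0%N; rewrite cf_length_gt0; split=> //.
  have lt_b := cf_b_incr cf_length_gt0; have lt_beta := cf_beta_decr cf_length_gt0.
  (* At [k = 0] the inequality reads [q * w1 <= 0]. *)
  have -> : w1 = 0 by move: le_k; rewrite /cf_beta /cf_a /cf_b /= expr0; nia.
  by rewrite mulr0 mulr_ge0.
have [le_b|/ltW lt_b] := leP ((b k)%:Z * w2) (beta k * w1); first by exists k.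
by apply: IH => //; apply: ltnW.
Qed.

Section Cone.
Variables (F : realFieldType) (V : lmodType F) (H1 H2 E : V).
Variables (w1 w2 m : int).

(* The weights of the two points are [(x' w2 - y' w1) / d] and
   [(y w1 - x w2) / d], where [d = x' y - x y']. *)
Lemma cone_two_points (S : set V) (x y x' y' : int) :
    S E -> S (x%:~R *: H1 + y%:~R *: H2 - E) ->
    S (x'%:~R *: H1 + y'%:~R *: H2 - E) ->
    0 < x' * y - x * y' -> x * w2 <= y * w1 -> y' * w1 <= x' * w2 ->
    (x' * y - x * y') * m <= (x' * w2 - y' * w1) + (y * w1 - x * w2) ->
  cone S (w1%:~R *: H1 + w2%:~R *: H2 - m%:~R *: E).
Proof.
move=> SE SC SC' d_gt0 le_t le_s le_m.
set d := x' * y - x * y' in d_gt0 le_m.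
set s := x' * w2 - y' * w1 in le_m; set t := y * w1 - x * w2 in le_m.
have dF_gt0 : 0 < d%:~R :> F by rewrite ltr0z.
(* What is left over is a multiple of [E], nonnegative by [le_m]. *)
suff -> : w1%:~R *: H1 + w2%:~R *: H2 - m%:~R *: E =
    d%:~R^-1 *: (s%:~R *: (x%:~R *: H1 + y%:~R *: H2 - E) +
      t%:~R *: (x'%:~R *: H1 + y'%:~R *: H2 - E) + (s + t - d * m)%:~R *: E).
  by apply: coneZ; rewrite ?invr_ge0 ?ltW //; apply: coneD; first apply: coneD;
    apply: coneZ; rewrite ?ler0z /s /t ?subr_ge0 //; apply: sub_cone.
(* Vectors are compared through their coefficients on [H1], [H2], [E], which reduces the identity to
   scalar ones. *)
pose L (x y z : F) : V := x *: H1 + y *: H2 + z *: E.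
have LD x1 y1 z1 x2 y2 z2 : L x1 y1 z1 + L x2 y2 z2 = L (x1 + x2) (y1 + y2) (z1 + z2).
  by rewrite /L !scalerDl [LHS]addrACA; congr (_ + _); rewrite addrACA.
have LZ c x1 y1 z1 : c *: L x1 y1 z1 = L (c * x1) (c * y1) (c * z1).
  by rewrite /L !scalerDr !scalerA.
have LC (x1 y1 z1 : F) : x1 *: H1 + y1 *: H2 - z1 *: E = L x1 y1 (- z1).
  by rewrite /L scaleNr.
have LC1 (x1 y1 : F) : x1 *: H1 + y1 *: H2 - E = L x1 y1 (- 1) by rewrite -LC scale1r.
have LE c : c *: E = L 0 0 c by rewrite /L !scale0r !add0r.
rewrite LC !LC1 LE !LZ !LD LZ /s /t /d !(rmorphD, rmorphN, rmorphM) /=.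
have d_neq0 : x'%:~R * y%:~R - x%:~R * y'%:~R != 0 :> F.
  by rewrite -!intrM -rmorphB intr_eq0; apply: lt0r_neq0.
by congr (L _ _ _); field.
Qed.

(** The last hypothesis says, scaled by [q], that the intersection numbers with all [C_i] are
    nonnegative. Two consecutive [C_i] bound a sector containing [(w1, w2)]; if one of them has
    nonnegative square, it is dropped and the sector is widened to its two neighbours. *)
Lemma cone_of_intersections :
    0 <= w1 -> 0 <= w2 ->
    (forall i, (i <= n)%N -> q%:Z * m <= (b i)%:Z * w2 + beta i * w1) ->
  cone ([set E] `|` [set (b i)%:R *: H1 + (beta i)%:~R *: H2 - E | i in
          [set i | (i <= n)%N /\ 2 * beta i * (b i)%:Z < q%:Z]])
    (w1%:~R *: H1 + w2%:~R *: H2 - m%:~R *: E).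
Proof.
move=> w1_ge0 w2_ge0 le_m; set S := (X in cone X).
have SE : S E by left.
have SC i : (i <= n)%N -> 2 * beta i * (b i)%:Z < q%:Z ->
    S ((b i)%:Z%:~R *: H1 + (beta i)%:~R *: H2 - E) by move=> le_in Ci; right; exists i.
have q_gt0 : 0 < q%:Z by lia.
(* [C_(i+1)] has nonnegative square; its neighbours then have negative square, and they enclose
   [(w1, w2)]. *)
have skip i : (i.+1 <= n)%N -> ~ 2 * beta i.+1 * (b i.+1)%:Z < q%:Z ->
    (b i)%:Z * w2 <= beta i * w1 ->
    ((i.+2 <= n)%N -> beta i.+2 * w1 <= (b i.+2)%:Z * w2) ->
    cone S (w1%:~R *: H1 + w2%:~R *: H2 - m%:~R *: E).
  move=> lt_in nC le_t le_s.
  (* [C_n] has negative square because [beta n = 0]. *)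
  have lt_in1 : (i.+1 < n)%N.
    rewrite ltn_neqAle lt_in andbT; apply/eqP => En; apply: nC.
    by rewrite En cf_beta_last mulr0 mul0r.
  have Ci : 2 * beta i * (b i)%:Z < q%:Z by case: (cf_negative_consecutive lt_in).
  have Ci2 : 2 * beta i.+2 * (b i.+2)%:Z < q%:Z.
    by case: (cf_negative_consecutive lt_in1).
  have d_gt0 : 0 < (b i.+2)%:Z * beta i - (b i)%:Z * beta i.+2.
    have := cf_b_incr lt_in; have := cf_b_incr lt_in1.
    have := cf_beta_decr lt_in; have := cf_beta_decr lt_in1.
    have := cf_beta_ge0 lt_in1; nia.
  apply: (cone_two_points SE (SC _ (ltnW lt_in) Ci) (SC _ lt_in1 Ci2)) => //.
    exact: le_s.
  (* C_(i+1) has nonnegative square and is orthogonal to C_i and C_(i+2). *)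
  rewrite -(ler_pM2l q_gt0) mulrCA.
  apply: le_trans (ler_wpM2l (ltW d_gt0) (le_m _ lt_in)) _.
  rewrite le_eqVlt; apply/orP; left; apply/eqP.
  rewrite [in RHS]mulrDr -{1}(cf_b_beta i) -(cf_b_beta i.+1).
  ring.
have [i [lt_in le_t le_s]] := cf_crossing w1_ge0 w2_ge0.
have [Ci|nCi] := pselect (2 * beta i * (b i)%:Z < q%:Z); last first.
  case: i => [|i] in lt_in le_t le_s nCi *.
    (* [C_0] has negative square because [b 0 = 0]. *)
    by case: nCi; rewrite /cf_b /= mulr0.
  apply: (skip i) => //; first exact: ltnW.
  have := cf_b_incr (ltnW lt_in); have := cf_beta_decr (ltnW lt_in); nia.
have [Ci1|nCi1] := pselect (2 * beta i.+1 * (b i.+1)%:Z < q%:Z); last first.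
  apply: (skip i) => // lt_in1.
  have := cf_b_incr lt_in1; have := cf_beta_decr lt_in1; nia.
have d_gt0 : 0 < (b i.+1)%:Z * beta i - (b i)%:Z * beta i.+1.
  by have := cf_b_incr lt_in; have := cf_beta_decr lt_in; have := cf_beta_ge0 lt_in; nia.
apply: (cone_two_points SE (SC _ (ltnW lt_in) Ci) (SC _ lt_in Ci1)) => //.
(* C_i has negative square and is orthogonal to C_(i+1). *)
rewrite -(ler_pM2l q_gt0) mulrCA.
apply: le_trans (ler_wpM2l (ltW d_gt0) (le_m _ (ltnW lt_in))) _.
rewrite -subr_ge0.
set s := (b i.+1)%:Z * w2 - beta i.+1 * w1; set t := beta i * w1 - (b i)%:Z * w2.
have -> : q%:Z * (s + t) - ((b i.+1)%:Z * beta i - (b i)%:Z * beta i.+1) *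
    ((b i)%:Z * w2 + beta i * w1) = s * (q%:Z - 2 * beta i * (b i)%:Z).
  by rewrite /s /t -(cf_b_beta i); ring.
by apply: mulr_ge0; rewrite subr_ge0 // ltW.
Qed.

End Cone.

End ContinuedFraction.

(** * Orders of polynomials *)

Lemma min_seq_le s z : z \in s -> min_seq s <= z.
Proof.
rewrite /min_seq; move: (head 0 s) => x0.
elim: s => // y s IH; rewrite inE big_cons ge_min => /orP[/eqP ->|/IH ->].
  by rewrite lexx.
by rewrite orbT.
Qed.

Lemma min_seq_mem s : s != [::] -> min_seq s \in s.
Proof.
move=> s_neq0; have h_s : head 0 s \in s by case: s s_neq0 => //= *; rewrite mem_head.
rewrite /min_seq big_seq; elim/big_ind: _ => // x y xs ys.
by rewrite minEle; case: ifP.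
Qed.

Lemma irreducible_polyC (D : idomainType) (c : D) :
  irreducible_elt c -> irreducible_elt c%:P.
Proof.
case=> c0 nu_c irr_c; split; first by rewrite polyC_eq0.
  by rewrite poly_unitE coefC negb_and nu_c orbT.
move=> g h E; have gh0 : g * h != 0 by rewrite -E polyC_eq0.
have [g0 h0] : g != 0 /\ h != 0 by move: gh0; rewrite mulf_eq0 negb_or => /andP[].
have := congr1 (fun p : {poly D} => size p) E.
rewrite size_polyC c0 size_mul //; move: g0 h0; rewrite -!size_poly_gt0 => sg sh Es.
have Eg : g = (g`_0)%:P by apply/size1_polyC; move: sg sh Es; lia.
have Eh : h = (h`_0)%:P by apply/size1_polyC; move: sg sh Es; lia.
move: E; rewrite Eg Eh -polyCM => /polyC_inj /irr_c[]; [left|right];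
  exact: (rmorph_unit polyC).
Qed.

(** In ['X = g * h] one factor is constant, and it divides the leading coefficient 1. *)
Lemma irreducible_polyX (D : idomainType) : irreducible_elt ('X : {poly D}).
Proof.
have X0 : ('X : {poly D}) != 0 by rewrite polyX_eq0.
suff unit_l (g h : {poly D}) : 'X = g * h -> (size g <= 1)%N -> g \is a GRing.unit.
  split; rewrite ?poly_unitE ?size_polyX // => g h E.
  have [sg|sg] := leqP (size g) 1; first by left; apply: unit_l E sg.
  right; apply: (unit_l h g); first by rewrite mulrC.
  have [g0 h0] : g != 0 /\ h != 0.
    by move: X0; rewrite E mulf_eq0 negb_or => /andP[].
  have := congr1 (fun p : {poly D} => size p) E; rewrite size_polyX size_mul //; lia.
move=> E /size1_polyC Eg; rewrite Eg; apply: (rmorph_unit polyC).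
have := congr1 (@lead_coef _) E; rewrite lead_coefX lead_coefM Eg lead_coefC => E1.
by apply/unitrP; exists (lead_coef h); rewrite coefC /= mulrC -E1.
Qed.

Section Polynomials.
Variable K : fieldType.
Notation Kxy := {poly {poly K}}.
Implicit Types (v : int * int) (f g h : Kxy) (X Y : {poly K}) (e : K * K).

Lemma mem_exponents f ij : (ij \in exponents f) = (f`_ij.2`_ij.1 != 0).
Proof.
rewrite mem_filter; case: eqVneq => //= fij; apply/allpairsPdep.
have lt_i : (ij.1 < size (f`_ij.2)%R)%N.
  by rewrite ltnNge; apply: contra_neqN fij => /leq_sizeP ->.
have lt_j : (ij.2 < size f)%N.
  by rewrite ltnNge; apply/negP => /leq_sizeP E; move: lt_i; rewrite E // size_poly0.
by exists ij.2, ij.1; rewrite !mem_iota; case: ij {fij} lt_i lt_j.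
Qed.

Lemma exponents_uniq f : uniq (exponents f).
Proof.
apply/filter_uniq/allpairs_uniq_dep => [|j _|]; try exact: iota_uniq.
by move=> [j i] [j' i'] _ _ /= [-> ->].
Qed.

Lemma exponents_neq0 f : (exponents f != [::]) = (f != 0).
Proof.
apply/idP/idP; first by apply: contra_neq => ->; rewrite /exponents size_poly0.
move=> f0; apply/eqP => E.
have := mem_exponents f ((size (lead_coef f)).-1, (size f).-1).
by rewrite E in_nil -/(lead_coef f) -/(lead_coef _) !lead_coef_eq0 f0.
Qed.

Definition pairing v (u : nat * nat) : int :=
  u.1%:Z * v.1 + u.2%:Z * v.2.

Lemma monomial_ord_le v f u : f`_u.2`_u.1 != 0 -> monomial_ord v f <= pairing v u.
Proof.
by move=> fu; apply: min_seq_le; apply: (map_f (pairing v)); rewrite mem_exponents.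
Qed.

Lemma monomial_ord_attained v f : f != 0 ->
  exists2 u, f`_u.2`_u.1 != 0 & monomial_ord v f = pairing v u.
Proof.
move=> f0; have : min_seq [seq pairing v u | u <- exponents f] \in
    [seq pairing v u | u <- exponents f].
  by apply: min_seq_mem; rewrite -size_eq0 size_map size_eq0 exponents_neq0.
by case/mapP => u; rewrite mem_exponents; exists u.
Qed.

Lemma monomial_ord_unique v f u : f`_u.2`_u.1 != 0 ->
  (forall u', f`_u'.2`_u'.1 != 0 -> pairing v u <= pairing v u') ->
  monomial_ord v f = pairing v u.
Proof.
move=> fu min_u; apply/le_anti; rewrite monomial_ord_le //=.
have f0 : f != 0 by apply: contra_neq fu => ->; rewrite !coef0.
by have [u' fu' ->] := monomial_ord_attained v f0; apply: min_u.
Qed.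

(** The width of the Newton polygon of [f] in direction [v]. For [(1, 0)] and [(p, q)] it gives the
    coefficients of the class of a curve on [H1] and [H2]. *)
Definition width (v : int * int) f : int :=
  - (monomial_ord v f + monomial_ord (- v.1, - v.2) f).

Lemma pairing_le_width v f u u' : f`_u.2`_u.1 != 0 -> f`_u'.2`_u'.1 != 0 ->
  pairing v u - pairing v u' <= width v f.
Proof.
move=> fu fu'; have := monomial_ord_le (- v.1, - v.2) fu.
by have := monomial_ord_le v fu'; rewrite /width /pairing /=; lia.
Qed.

Lemma width_ge0 v f : f != 0 -> 0 <= width v f.
Proof.
move=> f0; have [u fu _] := monomial_ord_attained v f0.
by apply: le_trans (pairing_le_width v fu fu); rewrite subrr.
Qed.

(** The value f(X, Y), written as a composite of ring morphisms so that it is one itself. *)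
Definition subst2 X Y : Kxy -> {poly K} := horner_eval Y \o map_poly (comp_poly X).
HB.instance Definition _ X Y := GRing.RMorphism.on (subst2 X Y).

Lemma subst2E X Y f : subst2 X Y f =
  \sum_(u <- exponents f) f`_u.2`_u.1 *: (X ^+ u.1 * Y ^+ u.2).
Proof.
rewrite /exponents big_filter big_mkcond big_allpairs_dep /=.
rewrite /subst2 /= /horner_eval (@horner_coef_wide _ (size f)) ?size_poly //.
rewrite -(big_mkord xpredT (fun j => (map_poly (comp_poly X) f)`_j * Y ^+ j)).
rewrite /index_iota subn0; apply: eq_bigr => j _; rewrite coef_map /= comp_polyE mulr_suml.
rewrite -(big_mkord xpredT (fun i => f`_j`_i *: X ^+ i * Y ^+ j)).
rewrite /index_iota subn0; apply: eq_bigr => i _; rewrite -scalerAl.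
by case: eqP => [->|//]; rewrite scale0r.
Qed.

Lemma subst2_translate e X Y f :
  subst2 (X - e.1%:P) (Y - e.2%:P) (translate e f) = subst2 X Y f.
Proof.
rewrite /subst2 /translate /= /horner_eval map_comp_poly horner_comp.
rewrite rmorphD /= map_polyX map_polyC /= comp_polyC hornerD hornerX hornerC subrK.
congr _.[_]; rewrite -map_poly_comp; apply: eq_map_poly => c /=.
by rewrite -comp_polyA comp_polyD comp_polyX comp_polyC subrK.
Qed.

Lemma mult_at_ge0 e f : 0 <= mult_at e f.
Proof.
(* The minimum over the empty sequence is 0, which settles the zero polynomial. *)
have [f0|f0] := eqVneq (translate e f) 0.
  by rewrite /mult_at f0 /monomial_ord /exponents size_poly0 /min_seq big_nil.
by rewrite /mult_at; have [u _ ->] := monomial_ord_attained (1, 1) f0;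
  rewrite /pairing /=; lia.
Qed.

Lemma mult_at_le e f u : (translate e f)`_u.2`_u.1 != 0 ->
  (`|mult_at e f|%N <= u.1 + u.2)%N.
Proof.
move=> fu; have := monomial_ord_le (1, 1) fu; have := mult_at_ge0 e f.
by rewrite /mult_at /pairing /=; lia.
Qed.

Lemma subst2_00 f : subst2 0 0 f = (f`_0`_0)%:P.
Proof. by rewrite /subst2 /= /horner_eval horner_coef0 coef_map /= comp_poly0r. Qed.

Lemma translate_00 e f : ((translate e f)`_0`_0)%:P = subst2 e.1%:P e.2%:P f.
Proof. by rewrite -[RHS](subst2_translate e) !subrr subst2_00. Qed.

Lemma mult_at_eq0 e f : subst2 e.1%:P e.2%:P f != 0 -> mult_at e f = 0.
Proof.
rewrite -translate_00 polyC_eq0 => /(@mult_at_le e f (0, 0)%N).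
by have := mult_at_ge0 e f; rewrite /=; lia.
Qed.

(** A substitution with nonzero value shows that the Taylor expansion at [e] is nonzero; vanishing
    at [e] removes its constant term. *)
Lemma mult_at_gt0 e f X Y :
  subst2 X Y f != 0 -> subst2 e.1%:P e.2%:P f = 0 -> 0 < mult_at e f.
Proof.
move=> f_neq0 fe0; have t0 : translate e f != 0.
  by apply: contra_neq f_neq0; rewrite -(subst2_translate e) => ->; rewrite rmorph0.
have t00 : (translate e f)`_0`_0 = 0.
  by apply/eqP; rewrite -polyC_eq0 translate_00 fe0.
rewrite /mult_at; have [[[|i] [|j]] + ->] := monomial_ord_attained (1, 1) t0;
  rewrite /pairing /= ?t00 ?eqxx //; lia.
Qed.

(** * Restriction to one-parameter subgroups *)

Section MonomialCurve.
Variables (e : K * K) (a b : nat).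
Hypotheses (e1_neq0 : e.1 != 0) (e2_neq0 : e.2 != 0).

Definition restrict : Kxy -> {poly K} := subst2 (e.1 *: 'X^a) (e.2 *: 'X^b).
HB.instance Definition _ := GRing.RMorphism.on restrict.

Lemma restrictE f : restrict f =
  \sum_(u <- exponents f)
     (f`_u.2`_u.1 * (e.1 ^+ u.1 * e.2 ^+ u.2)) *: 'X^(u.1 * a + u.2 * b).
Proof.
rewrite /restrict subst2E; apply: eq_bigr => u _.
rewrite !exprZn -!exprM -scalerAl -scalerAr !scalerA -exprD.
by rewrite ![(_ * u.2)%N]mulnC ![(_ * u.1)%N]mulnC mulrA.
Qed.

(** The Taylor expansion at [e] has only terms of degree at least the multiplicity, and both
    [x - e.1] and [y - e.2] restrict to multiples of [t - 1]. *)
Lemma restrict_mult_dvd f : ('X - 1%:P) ^+ `|mult_at e f|%N %| restrict f.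
Proof.
rewrite /restrict -(subst2_translate e) subst2E big_seq.
elim/big_ind: _ => [|x y dx dy|u]; rewrite ?dvdp0 //.
  exact: dvdp_add.
rewrite mem_exponents => fu; have le_m := mult_at_le fu; rewrite dvdpZr //.
apply: dvdp_trans (dvdp_exp2l _ le_m) _; rewrite exprD.
by apply: dvdp_mul; apply: dvdp_exp2r; rewrite dvdp_XsubCl rootE !hornerE;
  rewrite ?(expr1n, mulr1, subrr).
Qed.

(** For [u] and [u'] extremal in direction [(a, b)], the restriction has degree at most [N u] and is
    divisible by the coprime polynomials [t^(N u')] and [(t - 1)^m], where [m] is the
    multiplicity. *)
Lemma mult_le_width f : restrict f != 0 ->
  exists u u', [/\ f`_u.2`_u.1 != 0, f`_u'.2`_u'.1 != 0 &
    mult_at e f <= pairing (a%:Z, b%:Z) u - pairing (a%:Z, b%:Z) u'].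
Proof.
move=> rf0; have f0 : f != 0 by apply: contra_neq rf0 => ->; rewrite rmorph0.
have [u fu Eu] := monomial_ord_attained (- a%:Z, - b%:Z) f0.
have [u' fu' Eu'] := monomial_ord_attained (a%:Z, b%:Z) f0.
exists u, u'; split => //.
pose N (w : nat * nat) := (w.1 * a + w.2 * b)%N.
have leN w : f`_w.2`_w.1 != 0 -> (N u' <= N w <= N u)%N.
  move=> fw; have := monomial_ord_le (- a%:Z, - b%:Z) fw.
  by have := monomial_ord_le (a%:Z, b%:Z) fw; rewrite Eu Eu' /pairing /N /=; lia.
have dvdX : 'X^(N u') %| restrict f.
  rewrite restrictE big_seq; elim/big_ind: _ => [|x y dx dy|w].
  - exact: dvdp0.
  - exact: dvdp_add.
  rewrite mem_exponents => fw; have /andP[le _] := leN _ fw.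
  by rewrite dvdpZr ?dvdp_exp2l // !mulf_neq0 ?expf_neq0.
have size_r : (size (restrict f) <= (N u).+1)%N.
  rewrite restrictE big_seq; elim/big_ind: _.
  - by rewrite size_poly0.
  - by move=> x y sx sy; rewrite (leq_trans (size_polyD _ _)) // geq_max sx.
  move=> w; rewrite mem_exponents => fw; have /andP[_ le] := leN _ fw.
  by apply: leq_trans (size_scale_leq _ _) _; rewrite size_polyXn ltnS.
have cop : coprimep (('X - 1%:P) ^+ `|mult_at e f|%N) ('X^(N u') : {poly K}).
  apply: coprimep_expl; apply: coprimep_expr.
  by rewrite coprimepX rootE !hornerE oppr_eq0 oner_neq0.
have := Gauss_dvdp (restrict f) cop; rewrite restrict_mult_dvd dvdX => /(dvdp_leq rf0).
rewrite size_Mmonic ?monicXn ?expf_neq0 ?polyXsubC_eq0 // size_polyXn size_exp_XsubC.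
rewrite /pairing /N /= in size_r *; move: (mult_at_ge0 e f) size_r.
move: (size _) (mult_at e f) => s m; clear; lia.
Qed.

(** Distinct monomials of [f] restrict to distinct powers of [t], so nothing cancels. *)
Lemma restrict_inj f :
    (forall u u', f`_u.2`_u.1 != 0 -> f`_u'.2`_u'.1 != 0 ->
      (u.1 * a + u.2 * b = u'.1 * a + u'.2 * b)%N -> u = u') ->
  restrict f = 0 -> f = 0.
Proof.
move=> inj_f rf0; apply/eqP; rewrite -[_ == _]negbK -exponents_neq0; apply/negP.
case E : (exponents f) => [//|u s] _.
have u_f : u \in exponents f by rewrite E mem_head.
have := u_f; rewrite mem_exponents => fu.
move/(congr1 (coefp (u.1 * a + u.2 * b))): rf0.
rewrite /= restrictE coef_sumMXn coef0 big_mkcond (bigD1_seq u) ?exponents_uniq //= eqxx.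
rewrite big_seq_cond big1 ?addr0 => [/eqP|w /andP[]].
  by rewrite !mulf_eq0 !expf_eq0 (negPf fu) (negPf e1_neq0) (negPf e2_neq0) !andbF.
rewrite mem_exponents => fw /eqP nwu; case: ifP => // /eqP Ew.
by case: nwu; apply: inj_f.
Qed.

Lemma restrict_at1 f : (restrict f).[1]%:P = subst2 e.1%:P e.2%:P f.
Proof.
rewrite restrictE subst2E horner_sum rmorph_sum; apply: eq_bigr => u _ /=.
rewrite !hornerE expr1n mulr1 -!polyC_exp -polyCM -mul_polyC -polyCM.
by congr _%:P; rewrite mulrA.
Qed.

(** The equation of the closure of [t |-> e t^(a, b)], normalised as in [torus_curve]. Its
    coefficients need not be recorded, since the orders along the rays depend on the support
    alone. *)
Definition is_binomial_equation f :=
  [/\ lead_coef (lead_coef f) = 1, restrict f = 0,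
      forall g, restrict g = 0 -> exists k, g = k * f &
      forall u, (f`_u.2`_u.1 != 0) = (u == (b, 0)%N) || (u == (0, a)%N)].

(** The equation is monic in [y], so division by it leaves a remainder of [y]-degree below [a]; on
    such a remainder the restriction is injective, as [b] is invertible modulo [a]. *)
Lemma binomial_equation_a_gt0 : (0 < a)%N -> coprime a b ->
  is_binomial_equation ('X^a - ((e.2 ^+ a / e.1 ^+ b) *: 'X^b)%:P).
Proof.
(* The constant [c] makes the two monomials agree at [e]. *)
move=> a_gt0 co_ab; set c := _ / _; set f : Kxy := _ - _.
have c_neq0 : c != 0 by rewrite mulf_neq0 ?invr_eq0 ?expf_neq0.
have f_monic : f \is monic by apply: monicXnsubC.
have rf0 : restrict f = 0.
  rewrite /restrict /subst2 /f /= /horner_eval rmorphB /= map_polyXn map_polyC /=.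
  rewrite comp_polyZ comp_Xn_poly !hornerE !exprZn scalerA -!exprM mulfVK ?expf_neq0 //.
  by rewrite mulnC subrr.
split=> //; first by rewrite (monicP f_monic) lead_coef1.
  move=> g rg0; have Eg := Pdiv.RingMonic.rdivp_eq f_monic g.
  set k := Pdiv.CommonRing.rdivp g f in Eg; set r := Pdiv.CommonRing.rmodp g f in Eg.
  exists k; rewrite {1}Eg; suff -> : r = 0 by rewrite addr0.
  have lt_r u : r`_u.2`_u.1 != 0 -> (u.2 < a)%N.
    apply: contra_neqT; rewrite -leqNgt => le_au.
    rewrite [r`__]nth_default ?coef0 //; apply: leq_trans le_au.
    by have := Pdiv.Ring.ltn_rmodpN0 g (monic_neq0 f_monic); rewrite size_XnsubC.
  apply: restrict_inj; last first.
    by move: rg0; rewrite Eg rmorphD rmorphM /= rf0 mulr0 add0r.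
  move=> u u' /lt_r lt_u /lt_r lt_u' E.
  have E2 : u.2 = u'.2.
    have : u.2 * b = u'.2 * b %[mod a].
      by rewrite -[LHS](modnMDl u.1) E modnMDl.
    have cancel x y : (x <= y)%N -> (y < a)%N -> x * b = y * b %[mod a] -> x = y.
      move=> le_xy lt_ya /esym/eqP; rewrite eqn_mod_dvd ?leq_mul2r ?le_xy ?orbT //.
      rewrite -mulnBl Gauss_dvdl // => /dvdn_leq; lia.
    by case: (leqP u.2 u'.2) => [le|/ltnW le] E2; [|symmetry]; apply: cancel.
  move: E; rewrite E2 => /addIn /eqP; rewrite eqn_pmul2r // => /eqP E1.
  by case: u u' E1 E2 {lt_u lt_u'} => [? ?] [? ?] /= -> ->.
move=> [i j] /=; rewrite /f !coefE !xpair_eqE.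
have [->|nja] := eqVneq j a.
  rewrite (gtn_eqF a_gt0) andbF andbT coef0 subr0 mulr1n.
  by case: (i == 0%N); rewrite ?oner_neq0 ?eqxx.
rewrite andbF orbF mulr0n sub0r; case: (j == 0%N) => /=; last first.
  by rewrite coef0 oppr0 eqxx andbF.
rewrite coefZ coefXn andbT oppr_eq0 mulf_eq0 (negPf c_neq0) /=.
by case: (i == b); rewrite ?oner_neq0 ?eqxx.
Qed.

(** Here [y] does not occur in the equation, so the coefficients of the powers of [y] are divided
    one by one, with remainders constant in [x]. The curve [C_1] is of this kind. *)
Lemma binomial_equation_a_eq0 : a = 0%N -> b = 1%N ->
  is_binomial_equation ('X - e.1%:P)%:P.
Proof.
move=> a0 b1; set f : Kxy := _%:P.
have rf0 : restrict f = 0.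
  rewrite /restrict /subst2 /f /= /horner_eval map_polyC /= hornerC.
  by rewrite comp_polyB comp_polyX comp_polyC a0 expr0 -mul_polyC mulr1 subrr.
split=> //; first by rewrite lead_coefC lead_coefXsubC.
  move=> g rg0; pose k : Kxy := \poly_(j < size g) (g`_j %/ ('X - e.1%:P)).
  pose r : Kxy := g - k * f.
  exists k; suff r0 : r = 0 by apply/eqP; rewrite -subr_eq0 -/r r0.
  have lt_r u : r`_u.2`_u.1 != 0 -> u.1 = 0%N.
    apply: contra_neq_eq; rewrite -lt0n => u_gt0.
    rewrite /r coefB coefMC coef_poly; case: ltnP => [lt_u|ge_u]; last first.
      by rewrite mul0r subr0 (nth_default 0 ge_u) coef0.
    rewrite {1}(divp_eq g`_(u.2) ('X - e.1%:P)) addrC addKr.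
    rewrite nth_default //; apply: leq_trans u_gt0.
    have := ltn_modp g`_(u.2) ('X - e.1%:P).
    by rewrite size_XsubC polyXsubC_eq0.
  apply: restrict_inj; last by rewrite /r rmorphB rmorphM /= rg0 rf0 mulr0 subr0.
  move=> u u' /lt_r E1 /lt_r E1'; rewrite E1 E1' b1 !muln1 !mul0n !add0n => E2.
  by case: u u' E1 E1' E2 => [? ?] [? ?] /= -> -> ->.
move=> [i j] /=; rewrite /f coefC a0 b1 !xpair_eqE.
case: j => [|j] /=; last by rewrite coef0 !andbF eqxx.
by case: i => [|[|i]]; rewrite !coefE /= ?subr0 ?sub0r ?oppr_eq0 ?oner_neq0 ?eqxx ?e1_neq0.
Qed.

Lemma binomial_equation_exists : coprime a b -> exists f, is_binomial_equation f.
Proof.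
case: (posnP a) => [a0|a_gt0] co_ab; last first.
  by eexists; apply: binomial_equation_a_gt0.
eexists; apply: binomial_equation_a_eq0 => //.
by apply/eqP; move: co_ab; rewrite a0 /coprime gcd0n.
Qed.

Lemma unit_lead_coef1 f : f \is a GRing.unit -> lead_coef (lead_coef f) = 1 -> f = 1.
Proof.
rewrite !poly_unitE => /andP[/eqP sf /andP[/eqP sf0 _]].
have Ef : f = (f`_0)%:P by apply/size1_polyC; rewrite sf.
have Ef0 : f`_0 = (f`_0`_0)%:P by apply/size1_polyC; rewrite sf0.
by rewrite {1}Ef lead_coefC {1}Ef0 lead_coefC => E; rewrite Ef Ef0 E.
Qed.

(** Irreducibility makes [h] a unit, and the normalisation makes this unit 1. *)
Lemma torus_curve_dvd f g h :
    irreducible_elt f -> lead_coef (lead_coef f) = 1 -> is_torus_curve g ->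
  f = h * g -> f = g.
Proof.
move=> [_ _ irr_f] lf /and4P[/asboolP[_ nu_g _] _ _ /eqP lg] E.
have [u_h|u_g] := irr_f _ _ E; last by rewrite u_g in nu_g.
rewrite E (unit_lead_coef1 u_h) ?mul1r //.
by move: lf; rewrite E !lead_coefM lg mulr1.
Qed.

Lemma restrict_var_x : restrict (var_x K) = e.1 *: 'X^a.
Proof. by rewrite /restrict /subst2 /= /horner_eval map_polyC /= hornerC comp_polyX. Qed.

Lemma restrict_var_y : restrict (var_y K) = e.2 *: 'X^b.
Proof. by rewrite /restrict /subst2 /= /horner_eval map_polyX hornerX. Qed.

Lemma binomial_equation_torus_curve f : is_binomial_equation f -> is_torus_curve f.
Proof.
case=> lf rf0 ker_f _.
have f0 : f != 0.
  by apply: contra_eq_neq lf => ->; rewrite !lead_coef0 eq_sym oner_neq0.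
apply/and4P; split.
- apply/asboolP; split=> // [|g h Ef].
    apply/negP => u_f.
    have : restrict f \is a GRing.unit by apply: (rmorph_unit restrict).
    by rewrite rf0 unitr0.
  (* [K[t]] is a domain, so one factor lies in the kernel and is a multiple of [f]; the other is
     then a unit. *)
  have : restrict g * restrict h == 0 by rewrite -rmorphM /= -Ef rf0.
  rewrite mulf_eq0 => /orP[] /eqP /ker_f [k Ek]; [right|left]; apply/unitrP; exists k.
    suff Eh : k * h = 1 by split; rewrite // mulrC.
    by apply: (mulfI f0); rewrite mulr1 [RHS]Ef Ek; ring.
  suff Eg : k * g = 1 by split; rewrite // mulrC.
  by apply: (mulfI f0); rewrite mulr1 [RHS]Ef Ek; ring.
- apply: contra_eq_neq rf0 => ->; rewrite restrict_var_x.
  by rewrite scaler_eq0 negb_or e1_neq0 monic_neq0 // monicXn.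
- apply: contra_eq_neq rf0 => ->; rewrite restrict_var_y.
  by rewrite scaler_eq0 negb_or e2_neq0 monic_neq0 // monicXn.
by rewrite lf.
Qed.

(** A multiple of [f] that is itself irreducible and normalised is [f]; every other torus curve thus
    has a nonzero restriction. *)
Lemma restrict_eq0_binomial f g : is_binomial_equation f -> is_torus_curve g ->
  restrict g = 0 -> g = f.
Proof.
move=> bin_f /and4P[/asboolP irr_g _ _ /eqP lg].
have [_ _ ker_f _] := bin_f => /ker_f[k].
exact: torus_curve_dvd irr_g lg (binomial_equation_torus_curve bin_f).
Qed.

Lemma monomial_ord_binomial f v : is_binomial_equation f ->
  monomial_ord v f = Num.min (b%:Z * v.1) (a%:Z * v.2).
Proof.
case=> _ _ _ supp.
pose u : nat * nat := if b%:Z * v.1 <= a%:Z * v.2 then (b, 0)%N else (0, a)%N.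
have Eu : pairing v u = Num.min (b%:Z * v.1) (a%:Z * v.2).
  by rewrite minEle /u /pairing; case: ifP => _ /=; rewrite !mul0r ?addr0 ?add0r.
rewrite -Eu; apply: monomial_ord_unique.
  by rewrite supp /u; case: ifP; rewrite eqxx ?orbT.
move=> u'; rewrite supp Eu ge_min => /orP[] /eqP ->.
  by rewrite /pairing /= !mul0r !addr0 lexx.
by rewrite /pairing /= !mul0r !add0r lexx orbT.
Qed.

End MonomialCurve.

(** Bezout, with the sign left open so that both coefficients are natural numbers. *)
Lemma coprime_det a b : coprime a b ->
  exists a' b', `|b%:Z * a'%:Z - a%:Z * b'%:Z| = 1 :> int.
Proof.
move=> co_ab; have [a0|a_gt0] := posnP a.
  exists 1%N, 0%N; move: co_ab; rewrite a0 /coprime gcd0n => /eqP ->.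
  by rewrite mulr1 mul0r subr0.
case: (egcdnP b a_gt0) => b' a' E _; exists a', b'.
by move: E; rewrite (eqP co_ab); lia.
Qed.

(* The subgroup of [(a', b')] meets the curve transversally at [e]. *)
Lemma mult_at_binomial e a b f : e.1 != 0 -> e.2 != 0 -> coprime a b ->
  is_binomial_equation e a b f -> mult_at e f = 1.
Proof.
move=> e1_neq0 e2_neq0 /coprime_det[a' [b' det1]] bin_f.
have [lf rf0 _ supp] := bin_f.
have f0 : f != 0.
  by apply: contra_eq_neq lf => ->; rewrite !lead_coef0 eq_sym oner_neq0.
have rf_neq0 : restrict e a' b' f != 0.
  apply: contra_neq f0; apply: restrict_inj => // u u'.
  by rewrite !supp => /orP[] /eqP -> /orP[] /eqP -> //=; lia.
(* [f] vanishes at [e], and its width along [(a', b')] is [|b a' - a b'| = 1]. *)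
apply/le_anti; rewrite -gtz0_ge1 (mult_at_gt0 rf_neq0) ?andbT; last first.
  by rewrite -(restrict_at1 e a b) rf0 horner0.
have [u [u' [+ + le_m]]] := mult_le_width e1_neq0 e2_neq0 rf_neq0.
rewrite !supp => Eu Eu'; apply: le_trans le_m _; rewrite /pairing.
by case/orP: Eu Eu' => /eqP -> /orP[] /eqP -> /=; lia.
Qed.

(** [xget] may return any admissible exponent; uniqueness determines it. *)
Lemma curve_ord_unique f g m : (exists h, f = h * g ^+ m) ->
    (forall m', (exists h, f = h * g ^+ m') -> ~ (exists h, f = h * g ^+ m'.+1) -> m' = m) ->
    ~ (exists h, f = h * g ^+ m.+1) ->
  curve_ord g f = m%:Z.
Proof.
move=> dvd_m uniq_m ndvd_m; rewrite /curve_ord; case: xgetP => [m' _ [d nd]|/(_ m)].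
  by rewrite (uniq_m m').
by case.
Qed.

Lemma curve_ord_ndvd f g : (forall h, f <> h * g) -> curve_ord g f = 0.
Proof.
move=> ndvd; apply: (@curve_ord_unique _ _ 0%N).
- by exists f; rewrite expr0 mulr1.
- by case=> // m [h E] _; case: (ndvd (h * g ^+ m)); rewrite E exprSr mulrA.
by case=> h E; apply: (ndvd h); rewrite E expr1.
Qed.

Lemma curve_ord_self f : is_torus_curve f -> curve_ord f f = 1.
Proof.
case/and4P=> /asboolP[f0 nu_f _] _ _ _.
have ndvd m : ~ (exists h, f = h * f ^+ m.+2).
  case=> h E; case/negP: nu_f; apply/unitrP; exists (h * f ^+ m).
  suff E1 : h * f ^+ m * f = 1 by split; rewrite // mulrC.
  by apply: (mulfI f0); rewrite mulr1 [RHS]E !exprS; ring.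
apply: (@curve_ord_unique _ _ 1%N); first by exists 1; rewrite expr1 mul1r.
  case=> [|[|m]] //; first by move=> _ []; exists 1; rewrite expr1 mul1r.
  by move/ndvd.
exact: ndvd.
Qed.

Lemma curve_ord_torus_curve (f g : torus_curve K) :
  curve_ord (val g) (val f) = (f == g)%:Z.
Proof.
have [->|/eqP nfg] := eqVneq f g; first exact: curve_ord_self (valP g).
apply: curve_ord_ndvd => h E; apply: nfg; apply: val_inj.
case/and4P: (valP f) => /asboolP irr_f _ _ /eqP lf.
exact: torus_curve_dvd irr_f lf (valP g) E.
Qed.

Lemma curve_ord_unit (f : Kxy) (g : torus_curve K) :
  f \is a GRing.unit -> curve_ord (val g) f = 0.
Proof.
move=> u_f; apply: curve_ord_ndvd => h E; move: u_f; rewrite E unitrM.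
by case/andP=> _; case/and4P: (valP g) => /asboolP[_ /negPf ->].
Qed.

(** [x] is irreducible, so a torus curve dividing it would be [x], which [is_torus_curve]
    excludes. *)
Lemma curve_ord_var_x (g : torus_curve K) : curve_ord (val g) (var_x K) = 0.
Proof.
apply: curve_ord_ndvd => h E; case/and4P: (valP g) => _ /negP + _ _; apply.
have lx : lead_coef (lead_coef (var_x K)) = 1 by rewrite lead_coefC lead_coefX.
by rewrite -(torus_curve_dvd (irreducible_polyC (irreducible_polyX K)) lx (valP g) E).
Qed.

Lemma curve_ord_var_y (g : torus_curve K) : curve_ord (val g) (var_y K) = 0.
Proof.
apply: curve_ord_ndvd => h E; case/and4P: (valP g) => _ _ /negP + _; apply.
have ly : lead_coef (lead_coef (var_y K)) = 1 by rewrite lead_coefX lead_coef1.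
by rewrite -(torus_curve_dvd (irreducible_polyX _) ly (valP g) E).
Qed.

End Polynomials.

(** * Divisor classes *)

Section Classes.
Variables (R : realType) (K : fieldType) (e : K * K).
Variables (r : nat) (vs : r.-tuple (int * int)).
Implicit Types (D : divX K r) (Q : primeX K r).
Notation class := (class R e vs).
Notation primeD Q := (<< (Q : primeX K r) >> : divX K r).

Lemma coeff_realify D Q : coeff Q (realify R D) = (coeff Q D)%:~R.
Proof.
rewrite /realify raddf_sum /=.
under eq_bigr do rewrite coeffU.
have [Q_D|nQ_D] := boolP (Q \in dom D).
  rewrite (bigD1_seq Q) ?uniq_dom //= eqxx mulr1 big1 ?addr0 // => Q' /negPf ->.
  by rewrite mulr0.
rewrite (coeff_outdom nQ_D) big_seq big1 // => Q' Q'_D.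
by case: eqP => [E|]; [rewrite -E Q'_D in nQ_D | rewrite mulr0].
Qed.

Lemma realifyD D D' : realify R (D + D') = realify R D + realify R D'.
Proof.
by apply/eqP/freeg_eqP => Q; rewrite coeffD !coeff_realify coeffD rmorphD.
Qed.

Lemma realifyZ (c : int) D : realify R (c *: D) = c%:~R *: realify R D.
Proof.
by apply/eqP/freeg_eqP => Q; rewrite coeffZ !coeff_realify coeffZ rmorphM.
Qed.

Lemma classD D D' : class (D + D') = class D + class D'.
Proof. by rewrite /Defs.class realifyD lquot_piD. Qed.

Lemma classZ (c : int) D : class (c *: D) = c%:~R *: class D.
Proof. by rewrite /Defs.class realifyZ lquot_piZ. Qed.

Lemma class0 : class 0 = 0.
Proof. by rewrite -(scale0r (0 : divX K r)) classZ scale0r. Qed.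

Lemma class_sum (I : Type) (s : seq I) (G : I -> divX K r) :
  class (\sum_(i <- s) G i) = \sum_(i <- s) class (G i).
Proof. exact: (big_morph _ classD class0). Qed.

Lemma classE_sum D : class D = \sum_(Q <- dom D) (coeff Q D)%:~R *: class (primeD Q).
Proof.
rewrite -{1}(freeg_sumE D) class_sum; apply: eq_bigr => Q _.
rewrite -classZ; congr class; apply/eqP/freeg_eqP => Q'.
by rewrite coeffZ !coeffU mul1r.
Qed.

Lemma class_principal D : principal e vs D -> class D = 0.
Proof.
move=> prD; rewrite -class0; apply/lquot_eqP.
apply/asboolP; exists 1%N, (fun=> 1), (fun=> realify R D).
split; first by move=> _; exists D.
rewrite big_ord1 scale1r; apply/eqP/freeg_eqP => Q.
by rewrite coeffB !coeff_realify coeff0 subr0.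
Qed.

(** An effective divisor is a nonnegative combination of prime divisors. *)
Lemma Eff_sub_cone (S : set (ClR R e vs)) :
  (forall Q, cone S (class (primeD Q))) -> Eff R e vs `<=` cone S.
Proof.
move=> SQ; apply: cone_min => _ [D effD <-]; rewrite classE_sum.
by apply: cone_sum => Q _; apply: coneZ; rewrite ?ler0z.
Qed.

Lemma mult_at1 : mult_at e (1 : {poly {poly K}}) = 0.
Proof. by apply: mult_at_eq0; rewrite rmorph1 oner_neq0. Qed.

Lemma monomial_ord1 v : monomial_ord v (1 : {poly {poly K}}) = 0.
Proof.
rewrite (@monomial_ord_unique _ v 1 (0, 0)%N) /pairing /= ?mul0r //.
  by rewrite coef1 coef1 oner_neq0.
move=> [i j] /=; rewrite coef1; case: j => [|j]; last by rewrite coef0 eqxx.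
by rewrite coef1; case: i => [|i]; rewrite ?eqxx // !mul0r.
Qed.

Lemma ordX1 Q : ordX e vs Q 1 = 0.
Proof.
case: Q => [[i|g]|] /=; rewrite ?monomial_ord1 ?mult_at1 //.
exact/curve_ord_unit/unitr1.
Qed.

(** [Z] is the part of the divisor of [f] along curves of the torus. It will be the curve itself
    when [f] is its equation, and 0 when [f] is a coordinate. *)
Lemma class_div_eq0 (f : {poly {poly K}}) (Z : divX K r) : f != 0 ->
    (forall i, coeff (Some (inl i)) Z = 0) -> coeff None Z = 0 ->
    (forall g, coeff (Some (inr g)) Z = curve_ord (val g) f) ->
  class Z + \sum_(i < r) (monomial_ord (tnth vs i) f)%:~R *: class (primeD (Some (inl i)))
    + (mult_at e f)%:~R *: classE R e vs = 0.
Proof.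
move=> f0 Z_inl Z_None Z_inr.
under eq_bigr do rewrite -classZ.
rewrite -class_sum /classE -classZ -!classD; apply: class_principal.
exists f, 1; split=> // [|Q]; first exact: oner_neq0.
rewrite ordX1 subr0 !coeffD coeffZ /excX coeffU mul1r raddf_sum /=.
under eq_bigr do rewrite coeffZ coeffU mul1r.
case: Q => [[i|g]|] /=.
- rewrite Z_inl add0r mulr0 addr0 (bigD1 i) //= eqxx mulr1 big1 ?addr0 // => j nji.
  by case: eqP => [[E]|]; rewrite ?mulr0 // E eqxx in nji *.
- by rewrite Z_inr big1 ?mulr0 ?addr0 // => j _; rewrite mulr0.
- by rewrite Z_None big1 ?eqxx ?mulr1 ?add0r // => j _; rewrite mulr0.
Qed.

Lemma class_torus_curve (g : torus_curve K) : class (primeD (Some (inr g))) =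
  \sum_(i < r) (- monomial_ord (tnth vs i) (val g))%:~R *: class (primeD (Some (inl i)))
    - (mult_at e (val g))%:~R *: classE R e vs.
Proof.
have g0 : val g != 0 by case/and4P: (valP g) => /asboolP[].
have := @class_div_eq0 (val g) (primeD (Some (inr g))) g0 => H.
under eq_bigr do rewrite mulrNz scaleNr.
rewrite sumrN -opprD; apply/eqP; rewrite -addr_eq0 addrA H //.
- by move=> i; rewrite coeffU mul1r.
- by rewrite coeffU mul1r.
move=> g'; rewrite curve_ord_torus_curve coeffU mul1r.
by rewrite -[_ == Some _]/(g == g'); case: eqP.
Qed.

Lemma pullbackU (Q : Defs.primeP K r) :
  pullback e << Q >> = primeD (Some Q) + multP e Q *: excX K r.
Proof. by rewrite /pullback domU1 big_seq1 coeffU eqxx mulr1 scale1r. Qed.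

Lemma principal0 : principal e vs 0.
Proof.
by exists 1, 1; split=> [||Q]; rewrite ?oner_neq0 // coeff0 subrr.
Qed.

Lemma effective_prime Q : effective (primeD Q).
Proof. by move=> Q'; rewrite coeffU mul1r ler0n. Qed.

End Classes.

(** * Classes on the surface with rays (1, 0), (p, q) and their opposites *)

Section Surface.
Variables (p q : nat) (R : realType) (K : fieldType) (e : K * K).
Implicit Types (f : {poly {poly K}}) (v : int * int).
Notation n := (cf_length p q).
Notation a := (cf_a p q).
Notation b := (cf_b p q).
Notation beta := (cf_beta p q).

(** The Newton polygon is the segment from [(b, 0)] to [(0, a)], of width [|b v.1 - a v.2|]. *)
Lemma width_binomial i f : (i <= n)%N -> is_binomial_equation e (a i) (b i) f ->
  width (1, 0) f = b i /\ width (p%:Z, q%:Z) f = beta i.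
Proof.
move=> le_in bin_f; have := cf_beta_ge0 le_in.
rewrite /width !(monomial_ord_binomial _ bin_f) /= /cf_beta -signr_odd.
by case: (odd i); rewrite ?expr0 ?expr1; lia.
Qed.

Hypotheses (e1_neq0 : e.1 != 0) (e2_neq0 : e.2 != 0).
Notation class := (class R e (rays p q)).
Notation classE := (classE R e (rays p q)).
Notation H1 := (classH1 p q R e).
Notation H2 := (classH2 p q R e).
Notation invariantX i := (<< (Some (inl i) : primeX K 4) >> : divX K 4).

Lemma monomial_ord_var_x v : monomial_ord v (var_x K) = v.1.
Proof.
rewrite (@monomial_ord_unique _ v _ (1, 0)%N) /pairing /= ?mul0r ?mul1r ?addr0 //.
  by rewrite coefC /= coefX oner_neq0.
move=> [i j] /=; rewrite coefC; case: j => [|j] /=; last by rewrite coef0 eqxx.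
by rewrite coefX; case: i => [|[|i]]; rewrite ?eqxx //= !(mul0r, mul1r) addr0.
Qed.

Lemma monomial_ord_var_y v : monomial_ord v (var_y K) = v.2.
Proof.
rewrite (@monomial_ord_unique _ v _ (0, 1)%N) /pairing /= ?mul0r ?mul1r ?add0r //.
  by rewrite coefX /= coef1 oner_neq0.
move=> [i j] /=; rewrite coefX; case: j => [|[|j]] /=; rewrite ?coef0 ?eqxx //.
by rewrite coef1; case: i => [|i]; rewrite ?eqxx //= !(mul0r, mul1r) add0r.
Qed.

Lemma classH1E : class (invariantX 0) = H1.
Proof. by rewrite /classH1 pullbackU /= scale0r addr0. Qed.

Lemma classH2E : class (invariantX 1) = H2.
Proof. by rewrite /classH2 pullbackU /= scale0r addr0. Qed.

Lemma sum_invariant (c : int * int -> R) :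
  \sum_(i < 4) c (tnth (rays p q) i) *: class (invariantX i) =
    c (1, 0) *: H1 + c (p%:Z, q%:Z) *: H2 +
    c (-1, 0) *: class (invariantX (2 : 'I_4)) +
    c (- p%:Z, - q%:Z) *: class (invariantX (3 : 'I_4)).
Proof.
rewrite !big_ord_recl big_ord0 !(tnth_nth (0, 0)) /= addr0 -!addrA -classH1E -classH2E.
have -> : fintype.lift ord0 ord0 = 1 :> 'I_4 by apply: val_inj.
have -> : fintype.lift ord0 (fintype.lift ord0 ord0) = 2 :> 'I_4 by apply: val_inj.
by have -> : fintype.lift ord0 (fintype.lift ord0 (fintype.lift ord0 ord0)) = 3 :> 'I_4
  by apply: val_inj.
Qed.

Lemma class_var_eq0 (f : {poly {poly K}}) : f != 0 ->
  subst2 e.1%:P e.2%:P f != 0 -> (forall g : torus_curve K, curve_ord (val g) f = 0) ->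
  \sum_(i < 4) (monomial_ord (tnth (rays p q) i) f)%:~R *: class (invariantX i) = 0.
Proof.
move=> f0 fe0 f_ord; have := @class_div_eq0 R K e 4 (rays p q) f 0 f0.
rewrite mult_at_eq0 // scale0r addr0 class0 add0r; apply=> [i||g]; rewrite coeff0 //.
Qed.

Hypotheses (q_gt0 : (0 < q)%N).

(** The divisor of [y] is [q] times the difference of the curves of [(p, q)] and [(-p, -q)]; real
    coefficients permit division by [q]. *)
Lemma class_inv3 : class (invariantX (3 : 'I_4)) = H2.
Proof.
have y0 : var_y K != 0 by rewrite polyX_eq0.
have ye : subst2 e.1%:P e.2%:P (var_y K) != 0.
  by rewrite /subst2 /= /horner_eval map_polyX hornerX polyC_eq0.
have := class_var_eq0 y0 ye (@curve_ord_var_y K).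
rewrite (sum_invariant (fun v => (monomial_ord v (var_y K))%:~R)) !monomial_ord_var_y /=.
rewrite !scale0r addr0 add0r mulrNz scaleNr -scalerBr => /eqP.
by rewrite scaler_eq0 intr_eq0 eqz_nat (gtn_eqF q_gt0) subr_eq0 => /eqP.
Qed.

(** In the divisor of [x] the terms of [(p, q)] and [(-p, -q)] cancel by [class_inv3]. *)
Lemma class_inv2 : class (invariantX (2 : 'I_4)) = H1.
Proof.
have x0 : var_x K != 0 by rewrite polyC_eq0 polyX_eq0.
have xe : subst2 e.1%:P e.2%:P (var_x K) != 0.
  by rewrite /subst2 /= /horner_eval map_polyC hornerC /= comp_polyX polyC_eq0.
have := class_var_eq0 x0 xe (@curve_ord_var_x K).
rewrite (sum_invariant (fun v => (monomial_ord v (var_x K))%:~R)) !monomial_ord_var_x /=.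
rewrite class_inv3 !mulrNz !scaleNr !scale1r addrAC addrK => /eqP.
by rewrite subr_eq0 => /eqP.
Qed.

(** Opposite rays have curves of the same class, so the orders along them combine into a width. *)
Lemma class_torus_curve_H (g : torus_curve K) :
  class << (Some (inr g) : primeX K 4) >> =
    (width (1, 0) (val g))%:~R *: H1 + (width (p%:Z, q%:Z) (val g))%:~R *: H2
    - (mult_at e (val g))%:~R *: classE.
Proof.
rewrite class_torus_curve; congr (_ - _).
rewrite (sum_invariant (fun v => (- monomial_ord v (val g))%:~R)) class_inv2 class_inv3.
by rewrite -addrA addrACA -!scalerDl /width /= oppr0 !opprD !rmorphD.
Qed.

(** By [q (a, b) = b (p, q) + (-1)^i beta (1, 0)], the bound of [mult_le_width] splits into the two
    widths. The sign is harmless, since [width (1, 0)] bounds differences of both signs. *)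
Lemma intersection_ge0 i f : (i <= n)%N -> restrict e (a i) (b i) f != 0 ->
  q%:Z * mult_at e f <= (b i)%:Z * width (p%:Z, q%:Z) f + beta i * width (1, 0) f.
Proof.
move=> le_in rf0; have := cf_beta_ge0 le_in.
have [u [u' [fu fu' le_m]]] := mult_le_width e1_neq0 e2_neq0 rf0.
have w1 := pairing_le_width (1, 0) fu fu'; have w1' := pairing_le_width (1, 0) fu' fu.
have w2 := pairing_le_width (p%:Z, q%:Z) fu fu'.
move=> beta_ge0; apply: le_trans (ler_wpM2l (isT : 0 <= q%:Z) le_m) _.
have := ler_wpM2l (isT : 0 <= (b i)%:Z) w2.
have := ler_wpM2l beta_ge0 w1; have := ler_wpM2l beta_ge0 w1'.
rewrite /cf_beta -signr_odd /pairing /=; case: (odd i); rewrite ?expr0 ?expr1; nia.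
Qed.

End Surface.

(** * The generators of the effective cone *)

Section EffectiveCone.
Variables (p q : nat) (R : realType) (K : fieldType) (e : K * K).
Hypotheses (e1_neq0 : e.1 != 0) (e2_neq0 : e.2 != 0).
Hypotheses (p_gt0 : (0 < p)%N) (le_2p_q : (2 * p <= q)%N).
Notation H1 := (classH1 p q R e).
Notation H2 := (classH2 p q R e).
Notation primeD Q := (<< (Q : primeX K 4) >> : divX K 4).
Notation generators := ([set classE R e (rays p q)] `|`
  [set classC p q R e i | i in [set i : nat | (i <= cf_length p q)%N /\
     2 * cf_beta p q i * (cf_b p q i)%:Z < q%:Z]]).

Let q_gt0 : (0 < q)%N. Proof. lia. Qed.

Lemma class_binomial_curve i (g : torus_curve K) : (i <= cf_length p q)%N ->
    is_binomial_equation e (cf_a p q i) (cf_b p q i) (val g) ->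
  class R e (rays p q) (primeD (Some (inr g))) = classC p q R e i.
Proof.
move=> le_in bin_g; rewrite class_torus_curve_H //.
have [-> ->] := width_binomial le_in bin_g.
by rewrite (mult_at_binomial e1_neq0 e2_neq0 (cf_coprime p q i) bin_g) scale1r.
Qed.

Lemma binomial_curve_exists i : exists g : torus_curve K,
  is_binomial_equation e (cf_a p q i) (cf_b p q i) (val g).
Proof.
have [f bin_f] := binomial_equation_exists e1_neq0 e2_neq0 (cf_coprime p q i).
by exists (exist _ f (binomial_equation_torus_curve e1_neq0 e2_neq0 bin_f)).
Qed.

Lemma prime_in_cone (Q : primeX K 4) :
  cone generators (class R e (rays p q) (primeD Q)).
Proof.
have cone_w w1 w2 m := @cone_of_intersections p q p_gt0 le_2p_q _ _
  H1 H2 (classE R e (rays p q)) w1 w2 m.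
(* The weights [(1, 0)] with [m = 0] satisfy the bounds because [beta] is nonnegative. *)
have cone_H1 : cone generators H1.
  rewrite -[H1](_ : 1%:~R *: H1 + 0%:~R *: H2 - 0%:~R *: classE R e (rays p q) = _).
    by apply: cone_w => // i le_in; rewrite !mulr0 mulr1 add0r cf_beta_ge0.
  by rewrite !scale0r addr0 subr0 scale1r.
have cone_H2 : cone generators H2.
  rewrite -[H2](_ : 0%:~R *: H1 + 1%:~R *: H2 - 0%:~R *: classE R e (rays p q) = _).
    by apply: cone_w => // i le_in; rewrite !mulr0 mulr1 addr0.
  by rewrite !scale0r add0r subr0 scale1r.
case: Q => [[[[|[|[|[|//]]]] lt_j]|g]|]; last by apply: sub_cone; left.
- by rewrite (_ : Ordinal _ = 0) ?classH1E //; apply: val_inj.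
- by rewrite (_ : Ordinal _ = 1) ?classH2E //; apply: val_inj.
- by rewrite (_ : Ordinal _ = 2) ?class_inv2 //; apply: val_inj.
- by rewrite (_ : Ordinal _ = 3) ?class_inv3 //; apply: val_inj.
have [/and4P[/asboolP[g0 _ _] _ _ _]] := valP g.
(* A curve equal to some [C_i] of negative square is itself a generator; any other one meets all
   [C_i] nonnegatively. *)
have [[i [le_in neg_i rg0]]|no_i] := pselect (exists i, [/\ (i <= cf_length p q)%N,
    2 * cf_beta p q i * (cf_b p q i)%:Z < q%:Z &
    restrict e (cf_a p q i) (cf_b p q i) (val g) = 0]).
  apply: sub_cone; right; exists i => //; apply/esym/class_binomial_curve => //.
  have [f bin_f] := binomial_curve_exists i.
  by rewrite (restrict_eq0_binomial e1_neq0 e2_neq0 bin_f (valP g) rg0).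
rewrite class_torus_curve_H //; apply: cone_w; rewrite ?width_ge0 // => i le_in.
have [rg0|rg_neq0] := eqVneq (restrict e (cf_a p q i) (cf_b p q i) (val g)) 0; last first.
  exact: intersection_ge0.
have [f bin_f] := binomial_curve_exists i.
have bin_g : is_binomial_equation e (cf_a p q i) (cf_b p q i) (val g).
  by rewrite (restrict_eq0_binomial e1_neq0 e2_neq0 bin_f (valP g) rg0).
(* Here the curve is [C_i] itself, and the bound says [C_i^2 >= 0]; a negative square is excluded by
   [no_i]. *)
rewrite (mult_at_binomial e1_neq0 e2_neq0 (cf_coprime p q i) bin_g).
have [-> ->] := width_binomial le_in bin_g.
have [neg_i|] := ltP (2 * cf_beta p q i * (cf_b p q i)%:Z) q%:Z; last by lia.
by case: no_i; exists i.
Qed.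

(** Each [C_i] is the class of a prime curve of multiplicity 1 at [e], whose strict transform is the
    pullback of its closure minus [E]. *)
Lemma generators_mult1 :
  generators `<=` [set classE R e (rays p q)] `|` classes_mult1 R e (rays p q).
Proof.
move=> c [->|[i [le_in _] <-]]; [by left | right].
have [g bin_g] := binomial_curve_exists i.
exists (primeD (Some (inr g))), << (inr g : Defs.primeP K 4) >>, 1; split=> //.
- exact: effective_prime.
- rewrite pullbackU /= (mult_at_binomial e1_neq0 e2_neq0 (cf_coprime p q i) bin_g).
  by rewrite addrK /linearly_equivalent subrr; apply: principal0.
by apply/esym/class_binomial_curve.
Qed.

Lemma mult1_in_Eff :
  [set classE R e (rays p q)] `|` classes_mult1 R e (rays p q) `<=` Eff R e (rays p q).
Proof.
move=> c [->|[D [A [m [effD _ _ ->]]]]]; apply: sub_cone; last by exists D.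
by exists (excX K 4) => //; apply: effective_prime.
Qed.

End EffectiveCone.

Theorem theorem4p4 (R : realType) (K : closedFieldType) (charK0 : [pchar K] =i pred0)
    (e : K * K) (e1_neq0 : e.1 != 0) (e2_neq0 : e.2 != 0)
    (p q : nat) (p_gt0 : (0 < p)%N) (le_2p_q : (2 * p <= q)%N)
    (coprime_pq : coprime p q) :
  Eff R e (rays p q) =
    cone ([set classE R e (rays p q)] `|`
          [set classC p q R e i | i in
            [set i : nat | (i <= cf_length p q)%N /\
                           2 * cf_beta p q i * (cf_b p q i)%:Z < q%:Z]])
  /\ generated_in_multiplicity_1 R e (rays p q).
Proof.
have Eff_sub := Eff_sub_cone (@prime_in_cone p q R K e e1_neq0 e2_neq0 p_gt0 le_2p_q).
have gen_sub := @generators_mult1 p q R K e e1_neq0 e2_neq0 p_gt0 le_2p_q.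
have mult1_sub := @mult1_in_Eff p q R K e.
have cone_sub (S T : set (ClR R e (rays p q))) : S `<=` T -> cone S `<=` cone T.
  by move=> ST; apply: cone_min => v /ST; apply: sub_cone.
have mult1_cone_sub := cone_min mult1_sub.
(* The effective cone, the cone of the generators and the cone of multiplicity 1 are contained in
   one another cyclically. *)
split; apply/seteqP; split=> //.
- exact: subset_trans (cone_sub _ _ gen_sub) mult1_cone_sub.
- exact: subset_trans Eff_sub (cone_sub _ _ gen_sub).
Qed.
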